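(* Let the $m$-dimensional random vector $\boldsymbol\varepsilon$ have an elliptical distribution with $\mathrm E\,\boldsymbol\varepsilon=\mathbf 0$ and with a positive definite scatter matrix $\boldsymbol\Omega$. Then $H_0(\mathbf u)$ holds, i.e. $\mathcal L(\boldsymbol\varepsilon)=\mathcal L(\mathbf R_{\mathbf u}\boldsymbol\varepsilon)$, if and only if $\mathbf u$ is an eigenvector of $\boldsymbol\Omega$.
   Context: $m\ge2$ is an integer, $\mathbf u\in\mathbb R^m$ is a vector with $\|\mathbf u\|=1$, $\mathbf R_{\mathbf u}=2\mathbf u\mathbf u^\top-\mathbf I$, and $\mathcal L(\boldsymbol Z)$ denotes the distribution of $\boldsymbol Z$. A random vector $\boldsymbol Z$ is spherically symmetric around $\mathbf 0$ if $\mathcal L(\boldsymbol Z)=\mathcal L(\mathbf A\boldsymbol Z)$ for every orthogonal matrix $\mathbf A$. A random vector $\boldsymbol W$ has an elliptical distribution with location $\boldsymbol\mu$ and positive semidefinite scatter matrix $\boldsymbol\Omega$ if $\boldsymbol W=\boldsymbol\mu+\boldsymbol\Omega^{1/2}\boldsymbol Z$ for some $\boldsymbol Z$ spherically symmetric around $\mathbf 0$; here $\boldsymbol Z$ is non-degenerate (not almost surely $\mathbf 0$), so that the scatter matrix is specified uniquely up to a positive multiplicative constant. No finiteness of second moments is assumed. *)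

(* Defs.v *)
From HB Require Import structures.
From mathcomp Require Import all_boot all_order all_algebra.
From mathcomp Require Import complex.
From mathcomp Require Import all_classical all_reals all_analysis.

Set Implicit Arguments.
Unset Strict Implicit.
Unset Printing Implicit Defensive.

Import Order.TTheory GRing.Theory Num.Theory.
Import numFieldNormedType.Exports.

Local Open Scope classical_set_scope.
Local Open Scope ring_scope.

(* R^m is the space of column vectors with its Borel sigma-algebra. *)
HB.instance Definition _ (R : realType) (m : nat) :=
  @isMeasurable.Build (sigma_display (@open 'cV[R]_m)) 'cV[R]_m
    <<s @open 'cV[R]_m >> (@sigma_algebra0 _ setT _) (@sigma_algebraC _ _)
    (@sigma_algebra_bigcup _ setT _).

(* The norm provided by the library on matrices is the sup norm. *)
Definition euclid_norm (R : realType) (m : nat) (x : 'cV[R]_m) : R :=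
  Num.sqrt (\sum_i x i 0 ^+ 2).

Definition orthogonal_mx (R : realType) (m : nat) (A : 'M[R]_m) : Prop :=
  A^T *m A = 1%:M.

Definition psd_mx (R : realType) (m : nat) (A : 'M[R]_m) : Prop :=
  A^T = A /\ forall x : 'cV[R]_m, 0 <= (x^T *m A *m x) 0 0.

Definition posdef_mx (R : realType) (m : nat) (A : 'M[R]_m) : Prop :=
  A^T = A /\ forall x : 'cV[R]_m, x != 0 -> 0 < (x^T *m A *m x) 0 0.

(* The positive semidefinite square root, unique when A is positive
   semidefinite; psd_sqrtmxP shows that the default 0 is then not reached. *)
Definition sqrtmx (R : realType) (m : nat) (A : 'M[R]_m) : 'M[R]_m :=
  xget 0 [set S : 'M[R]_m | psd_mx S /\ S *m S = A].

Lemma poly_interpolation (F : fieldType) (g : F -> F) (s : seq F) :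
  exists p : {poly F}, {in s, forall x, p.[x] = g x}.
Proof.
elim: s => [|a s [p hp]]; first by exists 0.
have [as_|as_] := boolP (a \in s).
  by exists p => x; rewrite inE => /orP[/eqP->|]; exact: hp.
pose q : {poly F} := \prod_(x <- s) ('X - x%:P).
have qa : q.[a] != 0 by rewrite -/(root q a) root_prod_XsubC.
exists (p + ((g a - p.[a]) / q.[a])%:P * q) => x; rewrite inE !hornerE.
move=> /orP[/eqP->|xs]; first by rewrite divfK// addrC subrK.
have /rootP-> : root q x by rewrite root_prod_XsubC.
by rewrite mulr0 addr0 hp.
Qed.

Lemma tr_horner_mx (F : comNzRingType) n (A : 'M[F]_n.+1) p :
  (horner_mx A p)^T = horner_mx A^T p.
Proof.
elim/poly_ind: p => [|p c ih]; first by rewrite !raddf0.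
rewrite !rmorphD !rmorphM/= !horner_mx_X !horner_mx_C raddfD/= tr_scalar_mx.
rewrite trmx_mul ih; congr (_ + _).
exact: comm_mx_horner.
Qed.

Lemma psd_sqrtmx_ex (R : realType) (m : nat) (A : 'M[R]_m) :
  psd_mx A -> exists S : 'M[R]_m, psd_mx S /\ S *m S = A.
Proof.
case: m A => [|m] A [sA pA].
  exists 0; split; last by rewrite mulmx0 [RHS]flatmx0.
  by split=> [|x]; rewrite ?trmx0// mulmx0 mul0mx mxE.
pose f := real_complex R; pose B := map_mx f A.
have Bh : B \is hermsymmx.
  apply/is_hermitianmxP; rewrite expr0 scale1r; apply/matrixP => i j.
  by rewrite !mxE -[in LHS]sA mxE; apply/esym; exact: conjc_real.
have /orthomx_spectralP := hermitian_normalmx Bh.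
set P := spectralmx B; set sp := spectral_diag B => BE.
have Pu : P \is unitarymx by exact: spectral_unitarymx.
have spR : forall i, sp 0 i = f (complex.Re (sp 0 i)).
  move=> i; have /mxOverP/(_ 0 i) := hermitian_spectral_diag_real Bh.
  by move=> /RRe_real.
have sp_ge0 i : 0 <= complex.Re (sp 0 i).
  have e : P *m B *m invmx P = diag_mx sp.
    by rewrite BE !mulmxA mulmxV ?mul1mx ?mulmxK ?spectral_unit.
  have : (P *m B *m invmx P) i i = sp 0 i by rewrite e !mxE eqxx mulr1n.
  rewrite (invmx_unitary Pu).
  pose a : 'cV[R]_m.+1 := \col_j complex.Re (P i j).
  pose b : 'cV[R]_m.+1 := \col_j complex.Im (P i j).
  rewrite !mxE => /(congr1 (@complex.Re R)) <-.
  suff -> : complex.Re (\sum_j (P *m B) i j * (P ^t* )%sesqui j i) =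
      (a^T *m A *m a) 0 0 + (b^T *m A *m b) 0 0 by rewrite addr_ge0.
  rewrite !mxE raddf_sum -big_split/=; apply: eq_bigr => j _; rewrite !mxE.
  rewrite (_ : complex.Re _ =
      complex.Re (\sum_k P i k * B k j) * complex.Re (P i j) +
      complex.Im (\sum_k P i k * B k j) * complex.Im (P i j)); last first.
    by case: (\sum_k _) => ? ?; case: (P i j) => ? ? /=; rewrite mulrN opprK.
  congr (_ * _ + _ * _); rewrite raddf_sum; apply: eq_bigr => k _;
    rewrite !mxE /=; by case: (P i k) => ? ? /=; rewrite !(mulr0, subr0, add0r).
pose s := [seq complex.Re (sp 0 i) | i <- enum 'I_m.+1].
have [q hq] := @poly_interpolation R (fun x => Num.sqrt (Num.sqrt x)) s.
have qE : horner_mx A (q ^+ 4) = A.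
  apply: (map_mx_inj (f := f)); rewrite map_horner_mx -/B BE.
  rewrite horner_mx_uconjC; last exact: spectral_unit.
  rewrite horner_mx_diag; congr (_ *m diag_mx _ *m _); apply/rowP => i.
  rewrite !mxE spR horner_map/=; congr (_%:C)%C; rewrite horner_exp hq; last first.
    by apply/map_f; rewrite mem_enum.
  by rewrite (exprM _ 2 2) !sqr_sqrtr// sqrtr_ge0.
pose U := horner_mx A q.
have UT : U^T = U by rewrite tr_horner_mx sA.
exists (U *m U); split; last first.
  by rewrite -[RHS]qE rmorphXn/= -/U !exprS expr0 mulr1 -!mulmxE !mulmxA.
split=> [|x]; first by rewrite trmx_mul UT.
rewrite mulmxA -mulmxA -{1}UT -trmx_mul mxE sumr_ge0// => i _.
by rewrite mxE -expr2 sqr_ge0.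
Qed.

Lemma psd_sqrtmxP (R : realType) (m : nat) (A : 'M[R]_m) :
  psd_mx A -> psd_mx (sqrtmx A) /\ sqrtmx A *m sqrtmx A = A.
Proof.
move=> /psd_sqrtmx_ex[S hS]; exact: (@xgetPex _ 0 [set S | _] (ex_intro _ S hS)).
Qed.

Definition eigenvector (R : realType) (m : nat) (A : 'M[R]_m) (u : 'cV[R]_m)
    : Prop :=
  u != 0 /\ exists a : R, A *m u = a *: u.

(* 2 u u^T - I, the reflection across the line spanned by a unit vector u *)
Definition Rmx (R : realType) (m : nat) (u : 'cV[R]_m) : 'M[R]_m :=
  2 *: (u *m u^T) - 1%:M.

Section RandomVectors.
Context d (T : measurableType d) (R : realType) (P : probability T R) (m : nat).

(* X and Y are compared on Borel sets only: pushforward P X is a set function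
   on all subsets of R^m. *)
Definition same_law (X Y : T -> 'cV[R]_m) : Prop :=
  forall B : set 'cV[R]_m, measurable B ->
    pushforward P X B = pushforward P Y B.

(* Integrability is required explicitly: 'E_P[_] is total. *)
Definition has_mean (X : {RV P >-> 'cV[R]_m}) (v : 'cV[R]_m) : Prop :=
  forall i, P.-integrable setT (fun t => (X t i ord0)%:E) /\
    ('E_P[fun t => X t i ord0] = (v i ord0)%:E)%E.

Definition spherical (Z : {RV P >-> 'cV[R]_m}) : Prop :=
  forall A : 'M[R]_m, orthogonal_mx A -> same_law Z (fun t => A *m Z t).

Definition nondegenerate (Z : {RV P >-> 'cV[R]_m}) : Prop :=
  ~ {ae P, forall t, Z t = 0}.

Definition elliptical (W : {RV P >-> 'cV[R]_m}) (mu : 'cV[R]_m)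
    (Omega : 'M[R]_m) : Prop :=
  psd_mx Omega /\
  exists Z : {RV P >-> 'cV[R]_m}, [/\ spherical Z, nondegenerate Z &
    {ae P, forall t, W t = mu + sqrtmx Omega *m Z t}].

Definition H0 (X : {RV P >-> 'cV[R]_m}) (u : 'cV[R]_m) : Prop :=
  same_law X (fun t => Rmx u *m X t).

End RandomVectors.

(* Main.v *)
(* Write eps = mu + S Z with S = Omega^(1/2). The law of Z is invariant under -I,
   so mu = 0, and the first absolute moment E|v^T Z| depends only on the length
   of v; being homogeneous, it equals c |v| with 0 < c < oo. Hence
   E|w^T eps| = c (w^T Omega w)^(1/2), and H_0(u) forces the quadratic form of
   Omega to be R_u-invariant, which makes u an eigenvector. Conversely, if u is
   an eigenvector then R_u commutes with Omega, so A = S^-1 R_u S is orthogonal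
   and R_u S Z = S A Z has the law of S Z. *)

Require Import Defs.
From mathcomp Require Import all_boot all_order all_algebra.
From mathcomp Require Import all_classical all_reals all_analysis.
From mathcomp Require Import measurable_realfun.
From mathcomp Require Import ring lra.

Set Implicit Arguments.
Unset Strict Implicit.
Unset Printing Implicit Defensive.

Import Order.TTheory GRing.Theory Num.Theory.
Import numFieldNormedType.Exports.

Local Open Scope classical_set_scope.
Local Open Scope ring_scope.

(** * Reflections, quadratic forms and eigenvectors *)

Section LinearAlgebra.
Context (R : realType) (m : nat).
Implicit Types (u v w : 'cV[R]_m) (A Omega : 'M[R]_m).

Lemma trmx_mul_sum v w : (v^T *m w) 0 0 = \sum_i v i 0 * w i 0.
Proof. by rewrite mxE; apply: eq_bigr => i _; rewrite mxE. Qed.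

Lemma trmx_mul_self_ge0 v : 0 <= (v^T *m v) 0 0.
Proof. by rewrite trmx_mul_sum sumr_ge0// => i _; rewrite -expr2 sqr_ge0. Qed.

Lemma trmx_mul_self_eq0 v : (v^T *m v) 0 0 = 0 -> v = 0.
Proof.
rewrite trmx_mul_sum => /psumr_eq0P h; apply/colP => i; rewrite mxE.
by apply/eqP; rewrite -sqrf_eq0 expr2 h// => j _; rewrite -expr2 sqr_ge0.
Qed.

Lemma mulmx_trmx_scale u v w : u *m v^T *m w = (v^T *m w) 0 0 *: u.
Proof. by rewrite -mulmxA [v^T *m w in LHS]mx11_scalar mul_mx_scalar. Qed.

Lemma trmx_mulC v w : (v^T *m w) 0 0 = (w^T *m v) 0 0.
Proof. by rewrite !trmx_mul_sum; apply: eq_bigr => i _; rewrite mulrC. Qed.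

Lemma trmx_mulB u v w : (u^T *m (v - w)) 0 0 = (u^T *m v) 0 0 - (u^T *m w) 0 0.
Proof. by rewrite mulmxBr !mxE. Qed.

Lemma orthogonal_mx_transitive v w : (v^T *m v) 0 0 = (w^T *m w) 0 0 ->
  exists2 H : 'M[R]_m, orthogonal_mx H & H *m v = w.
Proof.
(* The case v = w is split off because v - w then spans no line to reflect along. *)
move=> vw; have [->|nvw] := eqVneq v w.
  by exists 1%:M; rewrite ?mul1mx// /orthogonal_mx trmx1 mulmx1.
(* H is the Householder reflection exchanging v and w. *)
pose n := v - w; pose a := (n^T *m n) 0 0.
have a0 : a != 0.
  by apply: contra_neq nvw => /trmx_mul_self_eq0/subr0_eq.
(* This is where equal lengths enter; it makes H subtract exactly n from v. *)
have aE : a = 2 * (n^T *m v) 0 0.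
  rewrite /a {2}/n !trmx_mulB (trmx_mulC n v) (trmx_mulC n w) !trmx_mulB.
  by rewrite (trmx_mulC w v) vw; ring.
pose H := 1%:M - (2 / a) *: (n *m n^T).
have HT : H^T = H.
  by rewrite /H linearB/= trmx1 linearZ/= trmx_mul trmxK.
have nn : n *m n^T *m (n *m n^T) = a *: (n *m n^T).
  by rewrite mulmxA mulmx_trmx_scale scalemxAl.
exists H.
  rewrite /orthogonal_mx HT /H mulmxBl mul1mx mulmxBr mulmx1 -scalemxAl.
  rewrite -scalemxAr nn; move: (n *m n^T) => N.
  by apply/matrixP => i j; rewrite !mxE; field.
rewrite mulmxBl mul1mx -scalemxAl mulmx_trmx_scale scalerA.
rewrite (_ : _ * _ = 1); first by rewrite scale1r /n opprB addrC subrK.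
by rewrite mulrAC -aE divff.
Qed.

Lemma posdef_unitmx Omega : posdef_mx Omega -> Omega \in unitmx.
Proof.
move=> [sO pO]; rewrite -row_free_unit; apply/inj_row_free => v vO.
apply/eqP; apply: contraT => v0; have /pO : v^T != 0.
  by apply: contra v0 => /eqP v0; rewrite -[v]trmxK v0 trmx0.
by rewrite trmxK vO mul0mx mxE ltxx.
Qed.

Lemma euclid_norm1 u : euclid_norm u = 1 -> (u^T *m u) 0 0 = 1.
Proof.
move=> /(congr1 (fun y : R => y ^+ 2)).
rewrite expr1n sqr_sqrtr; last by apply: sumr_ge0 => i _; exact: sqr_ge0.
by move=> <-; rewrite trmx_mul_sum; apply: eq_bigr => i _; rewrite expr2.
Qed.

Lemma Rmx_tr u : (Rmx u)^T = Rmx u.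
Proof. by rewrite /Rmx linearB/= trmx1 linearZ/= trmx_mul trmxK. Qed.

Lemma Rmx_mul u v : Rmx u *m v = (2 * (u^T *m v) 0 0) *: u - v.
Proof. by rewrite mulmxBl mul1mx -scalemxAl mulmx_trmx_scale scalerA. Qed.

Lemma Rmx_involutive u : (u^T *m u) 0 0 = 1 -> Rmx u *m Rmx u = 1%:M.
Proof.
move=> u1; have uu : u *m u^T *m (u *m u^T) = u *m u^T.
  by rewrite mulmxA mulmx_trmx_scale u1 scale1r.
rewrite /Rmx mulmxBl mul1mx mulmxBr mulmx1 -scalemxAl -scalemxAr uu scalerA.
by rewrite opprB addrA; apply/matrixP => i j; rewrite !mxE; ring.
Qed.

(** By symmetry u^T is a left eigenvector for the same a, so both products of Omega with u u^T equal
    a u u^T. *)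
Lemma Rmx_eigenvector_comm Omega u : Omega^T = Omega -> eigenvector Omega u ->
  Omega *m Rmx u = Rmx u *m Omega.
Proof.
move=> sO [_ [a Ou]].
have uO : u^T *m Omega = a *: u^T by rewrite -{1}sO -trmx_mul Ou linearZ.
rewrite /Rmx mulmxBl mulmxBr mulmx1 mul1mx -scalemxAl -scalemxAr -mulmxA uO.
by rewrite mulmxA Ou -scalemxAl -scalemxAr.
Qed.

(** The scalar s lets one expansion serve both u + v and u - v. *)
Lemma quad_formD A v w (s : R) :
  ((v + s *: w)^T *m A *m (v + s *: w)) 0 0 =
  (v^T *m A *m v) 0 0 + s ^+ 2 * (w^T *m A *m w) 0 0 +
  s * ((v^T *m A *m w) 0 0 + (w^T *m A *m v) 0 0).
Proof.
have -> : (v + s *: w)^T = v^T + s *: w^T by rewrite linearD linearZ.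
rewrite !mulmxDl !mulmxDr -!scalemxAl -!scalemxAr.
move: (v^T *m _ *m v) (v^T *m _ *m w) => a1 a2.
move: (w^T *m _ *m v) (w^T *m _ *m w) => a3 a4.
by rewrite !mxE; ring.
Qed.

(* Rmx u fixes u and negates its orthogonal complement, so comparing the form
   at u + v and u - v kills the cross term u^T Omega v for every v orthogonal
   to u, in particular for the component of Omega u orthogonal to u. *)
Lemma Rmx_invariant_form_eigenvector Omega u : Omega^T = Omega ->
    (u^T *m u) 0 0 = 1 ->
    (forall w, ((Rmx u *m w)^T *m Omega *m (Rmx u *m w)) 0 0 =
      (w^T *m Omega *m w) 0 0) ->
  eigenvector Omega u.
Proof.
move=> sO u1 hO; split.
  apply: contra_eqN u1 => /eqP ->.
  by rewrite mulmx0 mxE eq_sym oner_eq0.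
pose a := (u^T *m Omega *m u) 0 0; exists a.
pose v := Omega *m u - a *: u.
have uv : (u^T *m v) 0 0 = 0.
  by rewrite trmx_mulB mulmxA -/a -scalemxAr [X in _ - X]mxE u1 mulr1 subrr.
have RuE : Rmx u *m (u + v) = u - v.
  rewrite Rmx_mul mulmxDr mxE u1 uv addr0 mulr1.
  by apply/colP => i; rewrite !mxE; ring.
have vO : (v^T *m Omega *m u) 0 0 = (u^T *m Omega *m v) 0 0.
  by rewrite -mulmxA trmx_mulC trmx_mul sO.
have uOv : (u^T *m Omega *m v) 0 0 = 0.
  have := hO (u + v); rewrite RuE -scaleN1r -{3 4}[v]scale1r !quad_formD vO.
  by move=> /eqP; rewrite -subr_eq0 => /eqP h; lra.
(* As v is orthogonal to u, its squared length is v^T Omega u, the cross term that vanishes. *)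
apply/eqP; rewrite -subr_eq0 -/v; apply/eqP/trmx_mul_self_eq0.
rewrite {2}/v trmx_mulB mulmxA -scalemxAr [X in _ - X]mxE.
by rewrite (trmx_mulC v u) uv mulr0 subr0 -mulmxA trmx_mulC trmx_mul sO.
Qed.

End LinearAlgebra.

(** * Borel measurability of linear maps *)

Section BorelVectors.
Context (R : realType) (m n : nat).

(** A neighbourhood of a matrix contains a product of neighbourhoods of its finitely many entries,
    so continuity of each entry suffices. *)
Lemma continuous_mulmx (A : 'M[R]_(n, m)) :
  continuous (fun x : 'cV[R]_m => A *m x).
Proof.
move=> x B [C nC sCB].
have cA i j : continuous (fun y : 'cV[R]_m => (A *m y) i j).
  have -> : (fun y => (A *m y) i j) = (fun y => \sum_k A i k * y k j).
    by apply/funext => y; rewrite mxE.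
  apply: continuous_big => [|k _]; first exact: add_continuous.
  by move=> y; apply: cvgMr; [exact: nbhs_filter|exact: coord_continuous].
have h i j : \forall y \near x, C i j ((A *m y) i j) by exact/cA/nC.
have xF : Filter (nbhs x) := nbhs_filter x.
have : \forall y \near x, forall i j, C i j ((A *m y) i j).
  exact: (@filter_forall _ _ _ _ xF (fun i => @filter_forall _ _ _ _ xF (h i))).
exact: (@filterS _ (nbhs x) xF _ ((fun y => A *m y) @^-1` B) (fun y => sCB _)).
Qed.

Lemma continuous_measurable_mx (f : 'cV[R]_m -> 'cV[R]_n) :
  continuous f -> measurable_fun setT f.
Proof.
move=> /continuousP cf.
apply: (@measurability _ _ _ _ setT f (@open 'cV[R]_n) erefl) => _ [B oB <-].
by rewrite setTI; apply: sub_sigma_algebra; exact: cf.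
Qed.

Lemma measurable_coord (i : 'I_m) :
  measurable_fun setT (fun x : 'cV[R]_m => x i 0).
Proof.
apply: (measurability _ (RGenOpens.measurableE R)) => _ [_ [a [b ->]] <-].
rewrite setTI; apply: sub_sigma_algebra.
have /continuousP := @coord_continuous R m 1 i 0; apply.
exact: interval_open.
Qed.

Lemma measurable_mulmx (A : 'M[R]_(n, m)) :
  measurable_fun setT (fun x : 'cV[R]_m => A *m x).
Proof. by apply: continuous_measurable_mx; exact: continuous_mulmx. Qed.

End BorelVectors.

(** * Equality in law and integrals *)

Section Laws.
Context d (T : measurableType d) (R : realType) (P : probability T R) (m : nat).
Implicit Types X Y : T -> 'cV[R]_m.

Lemma ae_same_law X Y : measurable_fun setT X -> measurable_fun setT Y ->
  {ae P, forall t, X t = Y t} -> same_law P X Y.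
Proof.
move=> mX mY XY B mB; rewrite /pushforward.
have mXB : measurable (X @^-1` B) by rewrite -[_ @^-1` _]setTI; exact: mX.
have mYB : measurable (Y @^-1` B) by rewrite -[_ @^-1` _]setTI; exact: mY.
(* Probabilities become integrals of indicators, which ignore null sets. *)
rewrite -[X @^-1` B]setIT -[Y @^-1` B]setIT -!integral_indic//.
apply: (@ae_eq_integral _ _ _ P setT) => //.
- by apply/measurable_EFinP; exact: measurable_indic.
- by apply/measurable_EFinP; exact: measurable_indic.
- apply: filterS XY => t /= XYt _; rewrite !indicE.
  by congr ((nat_of_bool _)%:R%:E); apply/idP/idP; rewrite !inE/= XYt.
Qed.

(** Both sides are integrals of h against the image measures, which agree on Borel sets. *)
Lemma same_law_integral X Y (h : 'cV[R]_m -> \bar R) :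
    measurable_fun setT X -> measurable_fun setT Y -> same_law P X Y ->
    measurable_fun setT h ->
    P.-integrable setT (h \o X) -> P.-integrable setT (h \o Y) ->
  (\int[P]_t h (X t) = \int[P]_t h (Y t))%E.
Proof.
move=> mX mY XY mh iX iY.
have := integral_pushforward mX mh iX measurableT.
have := integral_pushforward mY mh iY measurableT.
rewrite !preimage_setT => <- <-.
by apply: eq_measure_integral => A mA _; exact: XY.
Qed.

End Laws.

(** * Laws and integrability under linear maps *)

Section LawTransport.
Context d (T : measurableType d) (R : realType) (P : probability T R) (m : nat).
Implicit Types X Y : T -> 'cV[R]_m.

Lemma measurable_mulmx_comp n (A : 'M[R]_(n, m)) X :
  measurable_fun setT X -> measurable_fun setT (fun t => A *m X t).
Proof. by move=> mX; apply: measurableT_comp mX; exact: measurable_mulmx. Qed.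

Lemma same_law_mulmx (A : 'M[R]_m) X Y : same_law P X Y ->
  same_law P (fun t => A *m X t) (fun t => A *m Y t).
Proof.
move=> XY B mB; apply: (XY ((fun x => A *m x) @^-1` B)).
by rewrite -[_ @^-1` _]setTI; exact: measurable_mulmx.
Qed.

Lemma measurable_linear_form (v : 'cV[R]_m) :
  measurable_fun setT (fun x : 'cV[R]_m => (v^T *m x) 0 0).
Proof.
by apply: (measurableT_comp (measurable_coord 0)); exact: measurable_mulmx.
Qed.

Lemma ae_eq_integrable (f g : T -> R) :
    measurable_fun setT f -> measurable_fun setT g -> {ae P, forall t, f t = g t} ->
  P.-integrable setT (EFin \o g) -> P.-integrable setT (EFin \o f).
Proof.
move=> mf mg fg /integrableP[_ ig]; apply/integrableP; split.
  exact/measurable_EFinP.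
apply: le_lt_trans ig; rewrite le_eqVlt; apply/orP; left; apply/eqP.
apply: ge0_ae_eq_integral => //.
- by apply: measurableT_comp => //; exact/measurable_EFinP.
- by apply: measurableT_comp => //; exact/measurable_EFinP.
- by apply: filterS fg => t /= ->.
Qed.

Lemma integrable_linear_form X :
    (forall i, P.-integrable setT (fun t => (X t i 0)%:E)) ->
  forall v : 'cV[R]_m, P.-integrable setT (fun t => ((v^T *m X t) 0 0)%:E).
Proof.
move=> iX v.
have -> : (fun t => ((v^T *m X t) 0 0)%:E) =
    (fun t => \sum_i ((v i 0)%:E * (X t i 0)%:E))%E.
  by apply/funext => t; rewrite trmx_mul_sum -sumEFin; apply: eq_bigr.
by apply: integrable_sum => // i _; exact: integrableZl.
Qed.

End LawTransport.

(** * First moments of linear forms in a spherical vector *)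

Section Spherical.
Context d (T : measurableType d) (R : realType) (P : probability T R) (m : nat).
Context (Z : {RV P >-> 'cV[R]_m}) (sphZ : spherical Z).
Context (intZ :
  forall v : 'cV[R]_m, P.-integrable setT (fun t => ((v^T *m Z t) 0 0)%:E)).
Implicit Types u v w : 'cV[R]_m.

(** This replaces the covariance, since second moments may be infinite. *)
Definition abs_moment v := (\int[P]_t `|(v^T *m Z t) 0 0|%:E)%E.

Lemma integrable_abs v : P.-integrable setT (fun t => `|(v^T *m Z t) 0 0|%:E).
Proof. exact: (integrable_norm (intZ v)). Qed.

(** Since -I is orthogonal, the integral equals its own opposite, and it is finite. *)
Lemma spherical_mean0 v : (\int[P]_t ((v^T *m Z t) 0 0)%:E)%E = 0%E.
Proof.
have oN : orthogonal_mx ((-1)%:M : 'M[R]_m).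
  by rewrite /orthogonal_mx tr_scalar_mx -scalar_mxM mulrNN mulr1.
have hN t : (v^T *m ((-1)%:M *m Z t)) 0 0 = - (v^T *m Z t) 0 0.
  by rewrite mul_scalar_mx scaleN1r mulmxN mxE.
have iN : P.-integrable setT (fun t => ((v^T *m ((-1)%:M *m Z t)) 0 0)%:E).
  under eq_fun do rewrite hN EFinN.
  exact: integrableN.
have mv : measurable_fun setT (fun x : 'cV[R]_m => ((v^T *m x) 0 0)%:E).
  by apply/measurable_EFinP; exact: measurable_linear_form.
have := same_law_integral (measurable_funPT Z)
  (measurable_mulmx_comp _ (measurable_funPT Z)) (sphZ oN) mv (intZ v) iN.
have -> : (\int[P]_t ((v^T *m ((-1)%:M *m Z t)) 0 0)%:E =
    - \int[P]_t ((v^T *m Z t) 0 0)%:E)%E.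
  under eq_integral do rewrite hN EFinN.
  by rewrite integralN//; exact: integrable_add_def.
have : (\int[P]_t ((v^T *m Z t) 0 0)%:E)%E \is a fin_num.
  exact: integrable_fin_num.
by case: (integral _ _ _) => // r _ [h]; congr EFin; lra.
Qed.

(** v^T C Z = (C^T v)^T Z, so the moment at C^T v depends only on the law of C Z. *)
Lemma same_law_abs_moment (A B : 'M[R]_m) v :
    same_law P (fun t => A *m Z t) (fun t => B *m Z t) ->
  abs_moment (A^T *m v) = abs_moment (B^T *m v).
Proof.
have E (C : 'M[R]_m) t : (v^T *m (C *m Z t)) 0 0 = ((C^T *m v)^T *m Z t) 0 0.
  by rewrite trmx_mul trmxK mulmxA.
have iC (C : 'M[R]_m) :
    P.-integrable setT (fun t => `|(v^T *m (C *m Z t)) 0 0|%:E).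
  by under eq_fun do rewrite E; exact: integrable_abs.
have mC (C : 'M[R]_m) := measurable_mulmx_comp C (measurable_funPT Z).
have mv : measurable_fun setT (fun x : 'cV[R]_m => `|(v^T *m x) 0 0|%:E).
  apply/measurable_EFinP; apply: measurableT_comp => //.
  exact: measurable_linear_form.
have IE (C : 'M[R]_m) :
    abs_moment (C^T *m v) = (\int[P]_t `|(v^T *m (C *m Z t)) 0 0|%:E)%E.
  by apply: eq_integral => t _; rewrite E.
move=> AB; rewrite !IE.
exact: (same_law_integral (mC A) (mC B) AB mv (iC A) (iC B)).
Qed.

Lemma spherical_abs_moment v w : (v^T *m v) 0 0 = (w^T *m w) 0 0 ->
  abs_moment v = abs_moment w.
Proof.
move=> /orthogonal_mx_transitive[H oH Hv].
(* Identity factors are inserted to reach the shape of [same_law_abs_moment], with H and 1 as the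
   two matrices. *)
rewrite -[v]mul1mx -[X in X *m v]trmx1 -[w]mul1mx -[X in X *m w]trmx1.
have -> : 1%:M^T *m v = H^T *m w by rewrite trmx1 mul1mx -Hv mulmxA oH mul1mx.
apply: same_law_abs_moment => B mB; rewrite -sphZ//.
by under [in RHS]eq_fun do rewrite mul1mx.
Qed.

Lemma abs_momentZ k v : abs_moment (k *: v) = (`|k|%:E * abs_moment v)%E.
Proof.
rewrite /abs_moment -integralZl//; last exact: integrable_abs.
apply: eq_integral => t _.
by rewrite linearZ/= -scalemxAl mxE normrM EFinM.
Qed.

(** Basis vectors as v make each coordinate vanish off a null set; finitely many null sets are
    joined. *)
Lemma abs_moment_eq0 : (forall v, abs_moment v = 0%E) -> {ae P, forall t, Z t = 0}.
Proof.
move=> M0.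
have h i : {ae P, forall t, Z t i 0 = 0}.
  have := M0 (delta_mx i 0); rewrite /abs_moment.
  have E t : ((delta_mx i 0 : 'cV[R]_m)^T *m Z t) 0 0 = Z t i 0.
    by rewrite trmx_delta -rowE mxE.
  under eq_integral do rewrite E -abse_EFin.
  have mZi : measurable_fun setT (fun t => (Z t i 0)%:E).
    apply/measurable_EFinP; apply: (measurableT_comp (measurable_coord i)).
    exact: measurable_funPT.
  move=> /(ae_eq_integral_abs P measurableT mZi).
  by apply: filterS => t /(_ I) [].
have := @filter_forall _ _ _ _ (ae_filter_ringOfSetsType P) h.
by apply: filterS => t Zt; apply/colP => i; rewrite Zt mxE.
Qed.

(* abs_moment v is the length of v times the finite constant abs_moment u, which
   is positive since Z is nondegenerate. *)
Lemma abs_moment_inj u v w : (u^T *m u) 0 0 = 1 -> Defs.nondegenerate Z ->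
  abs_moment v = abs_moment w -> (v^T *m v) 0 0 = (w^T *m w) 0 0.
Proof.
move=> u1 ndZ.
(* x has the same length as the multiple of u by (x^T x)^(1/2); homogeneity pulls this scalar
   out. *)
have ME x : abs_moment x = ((Num.sqrt ((x^T *m x) 0 0))%:E * abs_moment u)%E.
  rewrite -[X in X%:E]ger0_norm ?sqrtr_ge0// -abs_momentZ.
  apply: spherical_abs_moment; rewrite -scalemxAr linearZ/= -scalemxAl scalerA.
  by rewrite -expr2 sqr_sqrtr ?trmx_mul_self_ge0// [RHS]mxE u1 mulr1.
have : abs_moment u \is a fin_num.
  by apply: integrable_fin_num => //; exact: integrable_abs.
have : abs_moment u != 0%E.
  apply/eqP => M0; apply: ndZ; apply: abs_moment_eq0 => x.
  by rewrite ME M0 mule0.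
rewrite (ME v) (ME w); case: (abs_moment u) => // c c0 _ [].
move=> /(mulIf c0)/(congr1 (fun y : R => y ^+ 2)).
by rewrite !sqr_sqrtr ?trmx_mul_self_ge0.
Qed.

End Spherical.

(** * Symmetry under [Rmx u] against eigenvectors of the scatter matrix *)

Theorem lemma5 (d : measure_display) (T : measurableType d) (R : realType)
    (P : probability T R) (m : nat) (m_ge2 : (2 <= m)%N)
    (u : 'cV[R]_m) (u_unit : euclid_norm u = 1)
    (eps : {RV P >-> 'cV[R]_m}) (mu : 'cV[R]_m) (Omega : 'M[R]_m)
    (eps_elliptical : elliptical eps mu Omega)
    (eps_mean0 : has_mean eps 0)
    (Omega_posdef : posdef_mx Omega) :
  H0 eps u <-> eigenvector Omega u.
Proof.
have u1 := euclid_norm1 u_unit.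
have [psdO [Z [sphZ ndZ epsE]]] := eps_elliptical.
have [[]] := psd_sqrtmxP psdO; move: epsE.
move: (sqrtmx Omega) => S epsE sS _ SS.
have sO : Omega^T = Omega by case: Omega_posdef.
have uO := posdef_unitmx Omega_posdef.
have uS : S \in unitmx by move: uO; rewrite -SS unitmx_mul => /andP[].
have mZ : measurable_fun setT Z := measurable_funPT Z.
(* Integrability is given for [eps]; it passes to Z through v^T Z = w^T (eps - mu) almost
   everywhere, where w^T = v^T S^-1. *)
have intZ (v : 'cV[R]_m) : P.-integrable setT (fun t => ((v^T *m Z t) 0 0)%:E).
  pose w := (v^T *m invmx S)^T.
  apply: (@ae_eq_integrable _ _ _ P _
      (fun t => (w^T *m eps t) 0 0 - (w^T *m mu) 0 0)).
  - exact: (measurableT_comp (measurable_linear_form v)).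
  - apply: measurable_funB => //.
    exact: (measurableT_comp (measurable_linear_form w)).
  - apply: filterS epsE => t ->; rewrite mulmxDr [X in _ = X - _]mxE addrAC subrr.
    by rewrite add0r trmxK mulmxA mulmxKV.
  - rewrite /comp; under eq_fun do rewrite EFinB.
    apply: integrableB => //.
      by apply: integrable_linear_form => i; have [] := eps_mean0 i.
    exact: finite_measure_integrable_cst.
(* The mean of coordinate i of [eps] is mu_i plus the mean of v^T Z, with v^T the i-th row of S; the
   latter mean is 0. *)
have mu0 : mu = 0.
  apply/colP => i; have [ieps] := eps_mean0 i.
  pose v := (row i S)^T.
  have SZi t : (S *m Z t) i 0 = (v^T *m Z t) 0 0.
    by rewrite trmxK -row_mul [RHS]mxE.
  rewrite unlock (_ : (\int[P]_t _ = (mu i 0)%:E)%E); first by case.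
  transitivity (\int[P]_t ((mu i 0)%:E + ((v^T *m Z t) 0 0)%:E))%E.
    apply: ae_eq_integral => //.
    - by have /integrableP[] := ieps.
    - by apply: emeasurable_funD => //; have /integrableP[] := intZ v.
    - by apply: filterS epsE => t -> _; rewrite mxE SZi EFinD.
  rewrite integralD//; last exact: finite_measure_integrable_cst.
  by rewrite spherical_mean0// adde0 integral_cst//= probability_setT mule1.
have law_eps : same_law P eps (fun t => S *m Z t).
  apply: ae_same_law; [exact: measurable_funPT|exact: measurable_mulmx_comp|].
  by apply: filterS epsE => t ->; rewrite mu0 add0r.
have H0E : H0 eps u <->
    same_law P (fun t => S *m Z t) (fun t => (Rmx u *m S) *m Z t).
  have law_Reps := same_law_mulmx (Rmx u) law_eps.
  have RSE : (fun t => Rmx u *m (S *m Z t)) = (fun t => (Rmx u *m S) *m Z t).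
    by apply/funext => t; rewrite mulmxA.
  rewrite -RSE; split=> h B mB.
    exact: etrans (esym (law_eps B mB)) (etrans (h B mB) (law_Reps B mB)).
  exact: etrans (law_eps B mB) (etrans (h B mB) (esym (law_Reps B mB))).
rewrite H0E; split=> [law|eigu].
  apply: Rmx_invariant_form_eigenvector => // w.
  (* The form at x is the squared length of S x, so its invariance reduces to equal absolute moments
     at S w and S R_u w. *)
  have E x : (x^T *m Omega *m x) 0 0 = ((S^T *m x)^T *m (S^T *m x)) 0 0.
    by rewrite trmx_mul trmxK sS -SS !mulmxA.
  rewrite !E; apply/esym; apply: (abs_moment_inj sphZ intZ u1 ndZ).
  rewrite (same_law_abs_moment intZ _ law).
  by rewrite trmx_mul Rmx_tr mulmxA.
(* S^-1 R_u S is orthogonal as soon as R_u commutes with S^2 = Omega, so it need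
   not be shown that R_u commutes with S itself. *)
pose A := invmx S *m Rmx u *m S.
have RuO := Rmx_eigenvector_comm sO eigu.
have oA : orthogonal_mx A.
  have BB : invmx S *m invmx S = invmx Omega.
    apply: (can_inj (mulKmx uO)).
    by rewrite -{1}SS mulmxA mulmxK// !mulmxV.
  have RuV : Rmx u *m invmx Omega = invmx Omega *m Rmx u.
    apply: (can_inj (mulKmx uO)).
    by rewrite mulmxA RuO -mulmxA mulmxV// mulmx1 mulKVmx.
  rewrite /orthogonal_mx /A !trmx_mul trmx_inv sS Rmx_tr.
  (* A^T A = S R_u Omega^-1 R_u S; commuting R_u past Omega^-1 and R_u^2 = I leave S Omega^-1 S =
     I. *)
  transitivity (S *m (Rmx u *m (invmx S *m invmx S) *m Rmx u) *m S).
    by rewrite !mulmxA.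
  rewrite BB RuV -(mulmxA (invmx Omega)) Rmx_involutive// mulmx1 -BB.
  by rewrite !mulmxA mulmxV// mul1mx mulVmx.
have SA : S *m A = Rmx u *m S by rewrite /A !mulmxA mulmxV// mul1mx.
move=> B mB; rewrite (same_law_mulmx S (sphZ _ oA) mB).
congr (pushforward P _ B); by apply/funext => t; rewrite mulmxA SA.
Qed.
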